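(* Let $\mathbb{I}$ be the ring of Hurwitz integers. (a) For each odd $n \ge 5$ and any finite set $F\subseteq\mathbb{N}$ (with $\min F\ge 3$ in case $F\neq\emptyset$) which does not contain any divisors of $2$, $5$ or $10$, we have $Q_{U(\mathbb{I},F,n)} \ge \frac{10}{3}$. (b) Let $n \ge 6$ and let $F\subseteq\mathbb{N}$ be an arbitrary finite set such that $\min F \ge 3$ in case that $F \ne \emptyset$. Then $Q_{U(\mathbb{I},F,n)} \ge \frac{5}{2}$. (c) For each $n \ge 3$ we have $Q_{A(\mathbb{I},n)} \ge 4n-10$.
   Context: $R=\mathbb{I}$ is the ring of Hurwitz integers: all quaternions $z=q+r\mathbf{i}+s\mathbf{j}+t\mathbf{k}$ with either $q,r,s,t\in\mathbb{Z}$ or $q,r,s,t\in\frac12+\mathbb{Z}$, with the usual quaternion multiplication. Its norm is $N(z)=q^2+r^2+s^2+t^2\in\mathbb{Z}$. For a positive integer $m$, $\mathrm{rad}(m)$ is the largest square-free positive divisor of $m$. For $a=(a_1,\dots,a_n)\in R^n$ with all $a_j\neq 0$, the quality is $$q(a)=\frac{\log(\max(N(a_1),\dots,N(a_n)))}{\log(\mathrm{rad}(N(a_1\cdots a_n)))}.$$ For an infinite (countable) set $S=\{a^{(1)},a^{(2)},\dots\}$ of such $n$-tuples (enumerated without repetition), $Q_S=\limsup_{k\to\infty}q(a^{(k)})$ (possibly $+\infty$). The finitely many tuples consisting only of units, for which the denominator is $0$, are disregarded in the limsup. Let $n\ge 3$. $A(R,n)$ is the set of $a=(a_1,\dots,a_n)\in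 R^n$ with all $a_j\ne 0$ satisfying: (Z) $a_1+\dots+a_n=0$; (S1) there are no $b_1,\dots,b_n\in\{0,1\}$ and indices $i,j$ with $b_i=0$, $b_j=1$ and $\sum_{k=1}^n b_ka_k=0$; (G1) both the left g.c.d. and the right g.c.d. of $a_1,\dots,a_n$ equal $1$ (up to units). For a finite set $F\subseteq\mathbb{N}$ with $\min F\ge 3$ if $F\neq\emptyset$, $U(R,F,n)$ is the set of $a=(a_1,\dots,a_n)\in R^n$ with all $a_j\neq 0$ satisfying: (Z) $a_1+\dots+a_n=0$; (S2) there are no $b_1,\dots,b_n\in\{-1,0,1\}$ and indices $i,j$ with $b_i=0$, $b_j=1$ and $\sum_{k=1}^n b_ka_k=0$; (G2) for all $i<j$, both the left g.c.d. and the right g.c.d. of $a_i$ and $a_j$ equal $1$ (up to units); (F) none of $a_1,\dots,a_n$ is a multiple in $R$ of any element of $F$ (rational integers are central in $R$, so left and right multiples coincide). *)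

(* Defs.v *)
From HB Require Import structures.
From mathcomp Require Import all_boot all_order all_algebra finmap.
From mathcomp Require Import ring lra.
From mathcomp Require Import all_classical all_reals all_analysis.

Set Implicit Arguments.
Unset Strict Implicit.
Unset Printing Implicit Defensive.

Import Order.TTheory GRing.Theory Num.Theory.
Local Open Scope classical_set_scope.
Local Open Scope ring_scope.

(* [Quat q r s t] is q + r i + s j + t k. *)
Record quat := Quat { qre : rat; qi : rat; qj : rat; qk : rat }.

Definition quat_tuple (z : quat) := (qre z, qi z, qj z, qk z).
Definition tuple_quat (x : rat * rat * rat * rat) :=
  Quat x.1.1.1 x.1.1.2 x.1.2 x.2.
Lemma quat_tupleK : cancel quat_tuple tuple_quat. Proof. by case. Qed.

HB.instance Definition _ := Countable.copy quat (can_type quat_tupleK).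

Definition addq (z w : quat) :=
  Quat (qre z + qre w) (qi z + qi w) (qj z + qj w) (qk z + qk w).
Definition oppq (z : quat) := Quat (- qre z) (- qi z) (- qj z) (- qk z).
Definition mulq (z w : quat) := Quat
  (qre z * qre w - qi z * qi w - qj z * qj w - qk z * qk w)
  (qre z * qi w + qi z * qre w + qj z * qk w - qk z * qj w)
  (qre z * qj w - qi z * qk w + qj z * qre w + qk z * qi w)
  (qre z * qk w + qi z * qj w - qj z * qi w + qk z * qre w).

Fact addqA : associative addq.
Proof. by move=> [? ? ? ?] [? ? ? ?] [? ? ? ?]; rewrite /addq /= !addrA. Qed.
Fact addqC : commutative addq.
Proof. by move=> [? ? ? ?] [? ? ? ?]; congr Quat => /=; rewrite addrC. Qed.
Fact add0q : left_id (Quat 0 0 0 0) addq.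
Proof. by move=> [? ? ? ?]; rewrite /addq /= !add0r. Qed.
Fact addNq : left_inverse (Quat 0 0 0 0) oppq addq.
Proof. by move=> [? ? ? ?]; rewrite /addq /= !addNr. Qed.

HB.instance Definition _ := GRing.isZmodule.Build quat addqA addqC add0q addNq.

Fact mulqA : associative mulq.
Proof.
by move=> [? ? ? ?] [? ? ? ?] [? ? ? ?]; rewrite /mulq /=; congr Quat; ring.
Qed.
Fact mul1q : left_id (Quat 1 0 0 0) mulq.
Proof. by move=> [? ? ? ?]; rewrite /mulq /=; congr Quat; ring. Qed.
Fact mulq1 : right_id (Quat 1 0 0 0) mulq.
Proof. by move=> [? ? ? ?]; rewrite /mulq /=; congr Quat; ring. Qed.
Fact mulqDl : left_distributive mulq +%R.
Proof.
move=> [? ? ? ?] [? ? ? ?] [? ? ? ?].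
by rewrite /GRing.add /= /addq /mulq /=; congr Quat; ring.
Qed.
Fact mulqDr : right_distributive mulq +%R.
Proof.
move=> [? ? ? ?] [? ? ? ?] [? ? ? ?].
by rewrite /GRing.add /= /addq /mulq /=; congr Quat; ring.
Qed.
Fact oneq_neq0 : Quat 1 0 0 0 != 0.
Proof. by []. Qed.

HB.instance Definition _ := GRing.Zmodule_isNzRing.Build quat
  mulqA mul1q mulq1 mulqDl mulqDr oneq_neq0.

Lemma addqE z w : z + w = addq z w. Proof. by []. Qed.
Lemma oppqE z : - z = oppq z. Proof. by []. Qed.
Lemma mulqE z w : z * w = mulq z w. Proof. by []. Qed.

Definition normq (z : quat) : rat :=
  qre z ^+ 2 + qi z ^+ 2 + qj z ^+ 2 + qk z ^+ 2.

Definition hurwitz : {pred quat} := fun z =>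
  [&& qre z \is a Num.int, qi z \is a Num.int,
      qj z \is a Num.int & qk z \is a Num.int]
  || [&& qre z - 2^-1 \is a Num.int, qi z - 2^-1 \is a Num.int,
         qj z - 2^-1 \is a Num.int & qk z - 2^-1 \is a Num.int].

Lemma hurwitzP z :
  reflect (exists e a b c d : int,
            z = Quat (e%:~R / 2 + a%:~R) (e%:~R / 2 + b%:~R)
                     (e%:~R / 2 + c%:~R) (e%:~R / 2 + d%:~R))
          (z \in hurwitz).
Proof.
apply: (iffP idP).
  case: z => q r s t; rewrite unfold_in /= => /orP[] /and4P[].
    move=> /intrP[a ->] /intrP[b ->] /intrP[c ->] /intrP[d ->].
    by exists 0, a, b, c, d; rewrite mul0r !add0r.
  move=> /intrP[a qa] /intrP[b rb] /intrP[c sc] /intrP[d td].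
  exists 1, a, b, c, d; rewrite -qa -rb -sc -td mul1r; congr Quat; ring.
case=> e [a [b [c [d ->]]]]; rewrite unfold_in /=.
have [f [g [eE f01]]] : exists f g : int, e = f + g * 2 /\ (f = 0 \/ f = 1).
  exists (e %% 2)%Z, (e %/ 2)%Z; split; first by rewrite addrC -divz_eq.
  have := ltz_pmod e (isT : 0 < 2 :> int).
  have := modz_ge0 e (isT : 2 != 0 :> int).
  by case: (e %% 2)%Z => [[|[|n]]|n] // _ _; [left|right].
apply/orP; case: f01 eE => -> -> {e}; [left|right].
  have E x : (0 + g * 2)%:~R / 2 + x%:~R = (g + x)%:~R :> rat.
    by rewrite add0r intrM intrD mulfK.
  by rewrite !E !intr_int.
have E x : (1 + g * 2)%:~R / 2 + x%:~R - 2^-1 = (g + x)%:~R :> rat.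
  by rewrite !intrD intrM; field.
by rewrite !E !intr_int.
Qed.

Fact hurwitz_subring_closed : subring_closed hurwitz.
Proof.
split=> [|z w|z w].
- by apply/hurwitzP; exists 0, 1, 0, 0, 0; congr Quat; rewrite mul0r ?add0r.
- move=> /hurwitzP[e [a [b [c [d ->]]]]] /hurwitzP[e' [a' [b' [c' [d' ->]]]]].
  apply/hurwitzP; exists (e - e'), (a - a'), (b - b'), (c - c'), (d - d').
  rewrite oppqE addqE /oppq /addq /=.
  by congr Quat; rewrite ?(intrD, intrN); field.
- move=> /hurwitzP[e [a [b [c [d ->]]]]] /hurwitzP[e' [a' [b' [c' [d' ->]]]]].
  apply/hurwitzP.
  exists (- (e * e') + e * (a' - b' - c' - d') + e' * (a - b - c - d)),
    (a * a' - b * b' - c * c' - d * d'),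
    (a * b' + b * a' + c * d' - d * c' + e * e' + e * (b' + d') + e' * (b + c)),
    (a * c' - b * d' + c * a' + d * b' + e * e' + e * (c' + b') + e' * (c + d)),
    (a * d' + b * c' - c * b' + d * a' + e * e' + e * (d' + c') + e' * (d + b)).
  rewrite mulqE /mulq /=.
  by congr Quat; rewrite ?(intrD, intrN, intrM); field.
Qed.

HB.instance Definition _ :=
  GRing.isSubringClosed.Build quat hurwitz hurwitz_subring_closed.

Record hint := HInt { hint_val :> quat; hint_valP : hint_val \in hurwitz }.

HB.instance Definition _ := [isSub for hint_val].
HB.instance Definition _ := [Countable of hint by <:].
HB.instance Definition _ := [SubChoice_isSubNzRing of hint by <:].

Definition hnorm (z : hint) : nat := `|numq (normq z)|%N.

Lemma hnormE (z : hint) : (hnorm z)%:R = normq z.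
Proof.
have Nint : normq z \is a Num.int.
  case: z => z /= /hurwitzP[e [a [b [c [d ->]]]]]; apply/intrP.
  exists (e ^+ 2 + e * (a + b + c + d) + a ^+ 2 + b ^+ 2 + c ^+ 2 + d ^+ 2).
  by rewrite /normq /= !expr2 ?(intrD, intrM); field.
have N0 : 0 <= normq z by rewrite /normq !addr_ge0 ?sqr_ge0.
case/intrP: Nint N0 => m; rewrite /hnorm => ->; rewrite numq_int ler0z => m0.
by rewrite -[RHS](_ : (`|m|%N : int)%:~R = _) // gez0_abs.
Qed.

Section Divisibility.
Variable R : nzRingType.

Definition is_unit (u : R) := exists v, u * v = 1 /\ v * u = 1.

Definition left_divides (d x : R) := exists c, x = d * c.
Definition right_divides (d x : R) := exists c, x = c * d.

Definition is_left_gcd (d : R) (X : set R) :=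
  (forall x, X x -> left_divides d x) /\
  (forall e, (forall x, X x -> left_divides e x) -> left_divides e d).
Definition is_right_gcd (d : R) (X : set R) :=
  (forall x, X x -> right_divides d x) /\
  (forall e, (forall x, X x -> right_divides e x) -> right_divides e d).

End Divisibility.

Definition squarefree (m : nat) : Prop :=
  forall k : nat, (k ^ 2 %| m)%N -> k = 1%N.

(* Only meaningful for [0 < m]. *)
Definition rad (m : nat) : nat :=
  (\max_(d < m.+1 | (d %| m)%N && `[< squarefree d >]) d)%N.

(* Arbitrary point, needed only for [get] below. *)
HB.instance Definition _ n := isPointed.Build {ffun 'I_n -> hint} 0.

Section Quality.
Variables (R : realType) (n : nat).
Implicit Types (a : {ffun 'I_n -> hint}) (S : set {ffun 'I_n -> hint}).

Definition quality a : R :=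
  ln (\max_(i < n) hnorm (a i))%N%:R / ln (rad (hnorm (\prod_(i < n) a i)))%:R.

Definition unit_tuple a := forall i, is_unit (a i).

Definition enumerates (e : nat -> {ffun 'I_n -> hint}) S := set_bij setT S e.

(* The tuples of units are dropped from the limsup by restricting the filter
   of cofinite index sets. *)
Definition limsup_quality (e : nat -> {ffun 'I_n -> hint}) : \bar R :=
  limf_esup (fun k => (quality (e k))%:E)
            (within [set k | ~ unit_tuple (e k)] \oo).

(* Q_S, for infinite S; see [QE] for the independence of the enumeration. *)
Definition Q S : \bar R :=
  limsup_quality (get [set e | enumerates e S]).

Lemma enumerates_ex S : infinite_set S -> exists e, enumerates e S.
Proof.
move=> Sinf; have := eq_card_nat (countableP S) Sinf.
by rewrite card_eq_sym => /card_set_bijP[e eS]; exists e.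
Qed.

Lemma limsup_quality_le S e e' : enumerates e S -> enumerates e' S ->
  (limsup_quality e <= limsup_quality e')%E.
Proof.
move=> [eS einj eonto] [e'S e'inj e'onto].
have /choice[h hE] : forall j, exists i, e i = e' j.
  by move=> j; have [i _ <-] := eonto _ (e'S j I); exists i.
have /choice[g gE] : forall i, exists j, e' j = e i.
  by move=> i; have [j _ <-] := e'onto _ (eS i I); exists j.
apply: le_ereal_inf_tmp => _ [V [N _ NV] <-].
pose M := (\max_(j < N) h j).+1.
pose W := [set k | ~ unit_tuple (e k) /\ (M <= k)%N].
apply: (@le_trans _ _ (ereal_sup ((fun k => (quality (e k))%:E) @` W))).
  apply: ereal_inf_lbound; exists W => //.
  by exists M => // k /= Mk nuk; split.
apply: ge_ereal_sup => _ [k [nuk Mk] <-].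
apply: ereal_sup_ubound; exists (g k); last by rewrite gE.
apply: NV; last by rewrite /= gE.
rewrite /= leqNgt; apply/negP => gN.
have kE : k = h (g k) by apply: einj; rewrite ?inE // hE gE.
move: Mk; rewrite /M leqNgt ltnS => /negP; apply.
rewrite {1}kE.
exact: (@leq_bigmax _ (fun j : 'I_N => h j) (Ordinal gN)).
Qed.

Lemma QE S e : enumerates e S -> Q S = limsup_quality e.
Proof.
move=> eS.
have xS := @getPex _ [set f | enumerates f S] (ex_intro _ e eS).
by apply/eqP; rewrite eq_le !(@limsup_quality_le S).
Qed.

End Quality.

Section Tuples.
Variable n : nat.
Implicit Types (a : {ffun 'I_n -> hint}).

Definition nonzero_tuple a := forall j, a j != 0.

(* [B] is the set of coefficients allowed in the subsums. *)
Definition no_vanishing_subsum (B : seq int) a :=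
  ~ exists (b : 'I_n -> int) (i j : 'I_n),
      [/\ forall k, b k \in B, b i = 0, b j = 1 & \sum_k a k *~ b k = 0].

Definition A : set {ffun 'I_n -> hint} := [set a |
  [/\ nonzero_tuple a,
      \sum_j a j = 0,
      no_vanishing_subsum [:: 0; 1] a &
      is_left_gcd 1 (range a) /\ is_right_gcd 1 (range a)]].

Definition U (F : {fset nat}) : set {ffun 'I_n -> hint} := [set a |
  [/\ nonzero_tuple a,
      \sum_j a j = 0,
      no_vanishing_subsum [:: -1; 0; 1] a,
      forall i j : 'I_n, (i < j)%N ->
        is_left_gcd 1 [set a i; a j] /\ is_right_gcd 1 [set a i; a j] &
      forall j f, f \in F -> ~ left_divides f%:R (a j)]].

End Tuples.
Arguments A : clear implicits.
Arguments U : clear implicits.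

(* Main.v *)
Require Import Defs.
From mathcomp Require Import all_boot all_order all_algebra finmap.
From mathcomp Require Import zify ring.
From mathcomp Require Import all_classical all_reals all_analysis.

Import Order.TTheory GRing.Theory Num.Theory.
Local Open Scope classical_set_scope.
Local Open Scope ring_scope.

(* In the Hurwitz integers the qualities are unbounded on every U(n, F) with
   n >= 3, so all the lower bounds hold with Q = +oo. Since 9^(2^t) - 1 factors
   as (9 - 1)(9 + 1)(9^2 + 1)(9^4 + 1)..., it is a sum of two squares r^2 + s^2.
   With u = r i + s j, both u - 1 and -u - 1 have norm 9^(2^t), a power of 3,
   while their sum is the constant -2. It remains to split 2 into n - 2
   pairwise coprime constants c_l = a_l + K x_l k that do not depend on t: then
   the radical of the norm of the product stays bounded as t grows.
   The a_l are in {1, -1, 2} and add up to 2, so no c_l is a multiple of an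
   integer f >= 3; the x_l are powers of 5 and minus their sum, which rules out
   vanishing subsums; K is divisible by 3 and by all a_m x_l - a_l x_m, and since
   a_m c_l - a_l c_m = K (a_m x_l - a_l x_m) k, a common divisor of c_l and c_m
   divides both a power of K and the norm 1 + K^2 x_l^2 of c_l. *)

(** * Radicals of a prime power times a fixed factor *)

(** Since [d] divides [gcdn d (p ^ e) * L], only the power of [p] inside [d] matters, and
    squarefreeness allows at most the first power. *)
Lemma dvdn_squarefree_leq (p e L d : nat) : prime p -> (0 < L)%N ->
  squarefree d -> (d %| p ^ e * L)%N -> (d <= p * L)%N.
Proof.
move=> pp L0 sqfd dpL.
have dgL : (d %| gcdn d (p ^ e) * L)%N by rewrite muln_gcdl dvdn_gcd dpL dvdn_mulr.
apply: dvdn_leq; first by rewrite muln_gt0 prime_gt0.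
apply: (dvdn_trans dgL); rewrite dvdn_mul //.
have /(dvdn_pfactor _ _ pp)[[|[|f]] _ gE] := dvdn_gcdr d (p ^ e);
  rewrite gE ?dvd1n ?expn1 //.
have : (p ^ 2 %| d)%N.
  by apply: (dvdn_trans _ (dvdn_gcdl d (p ^ e))); rewrite gE dvdn_exp2l.
by move/sqfd => p1; move: pp; rewrite p1.
Qed.

Lemma rad_leq (p e L : nat) : prime p -> (0 < L)%N ->
  (Defs.rad (p ^ e * L) <= p * L)%N.
Proof.
move=> pp L0; apply/bigmax_leqP => d /andP[dd /asboolP sd].
exact: dvdn_squarefree_leq dd.
Qed.

Lemma prime_squarefree (p : nat) : prime p -> squarefree p.
Proof.
move=> pp k kp.
have : (k %| p)%N by apply: dvdn_trans kp; rewrite dvdn_exp.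
move/(primeP pp).2/pred2P => [//|kE]; move: kp; rewrite kE => /(dvdn_leq (prime_gt0 pp)).
by rewrite leqNgt -{1}(expn1 p) ltn_exp2l ?prime_gt1.
Qed.

Lemma leq_rad (p m : nat) : prime p -> (0 < m)%N -> (p %| m)%N -> (p <= Defs.rad m)%N.
Proof.
move=> pp m0 pm; have pm1 : (p < m.+1)%N by rewrite ltnS dvdn_leq.
apply: (@leq_bigmax_cond _ _ (fun d : 'I_m.+1 => d : nat) (Ordinal pm1)) => /=.
by rewrite pm; apply/asboolP/prime_squarefree.
Qed.

(** * Unbounded quality forces an infinite limsup *)

Section UnboundedQuality.
Variables (R : realType) (n : nat) (S : set {ffun 'I_n -> hint}).
Hypothesis unbounded : forall M : R,
  exists a, [/\ S a, ~ unit_tuple a & M < quality R a].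

Let finite_quality_bound (s : seq {ffun 'I_n -> hint}) :
  exists M : R, forall a, a \in s -> quality R a <= M.
Proof.
elim: s => [|b s [M sM]]; first by exists 0.
exists (Num.max (quality R b) M) => a; rewrite in_cons le_max => /predU1P[->|/sM ->].
  by rewrite lexx.
by rewrite orbT.
Qed.

Lemma infinite_quality_unbounded : infinite_set S.
Proof.
move=> /finite_seqP[s SE]; have [M sM] := finite_quality_bound s.
have [a [Sa _]] := unbounded M; rewrite ltNge sM //.
by move: Sa; rewrite SE.
Qed.

Lemma Q_quality_unbounded : Q R S = +oo%E.
Proof.
have [e eS] := enumerates_ex infinite_quality_unbounded.
rewrite (QE R eS) /limsup_quality limf_esupE; apply/ereal_inf_pinfty.
move=> _ [V [N _ NV] <-]; apply/eqyP => M _.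
(* [M'] bounds the qualities at the first [N] indices, so a tuple of larger quality must occur in
   the tail. *)
have [M' eM'] := finite_quality_bound [seq e k | k <- iota 0 N].
have [a [Sa au]] := unbounded (Num.max M M'); rewrite gt_max => /andP[Ma M'a].
case: eS => _ _ /(_ _ Sa)[k _ ka].
apply: (@le_trans _ _ (quality R a)%:E); first by rewrite lee_fin ltW.
apply: ereal_sup_ubound; exists k; last by rewrite ka.
apply: NV; last by rewrite /= ka.
rewrite /= leqNgt; apply/negP => kN.
move: M'a; rewrite ltNge eM' // -ka; apply: map_f.
by rewrite mem_iota.
Qed.

End UnboundedQuality.

(** * Integer components of the constants *)

(** Modulo 5 the sum reduces to [x 0], which is too small to be a nonzero multiple of 5; divide by 5
    and repeat. *)
Lemma digits5_eq0 (p : nat) (x : nat -> int) :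
  (forall i, (i < p)%N -> `|x i| <= 4) -> \sum_(i < p) x i * 5 ^+ i = 0 ->
  forall i, (i < p)%N -> x i = 0.
Proof.
elim: p x => [//|p IHp] x x4; rewrite big_ord_recl /= expr0 mulr1.
under eq_bigr => i _ do rewrite /bump /= add1n exprS mulrCA.
rewrite -mulr_sumr; set T := \sum_(i < p) _ => S0.
have x0 := x4 0%N isT.
have [x00 T0] : x 0%N = 0 /\ T = 0 by lia.
by case=> [//|i]; apply: (IHp (fun i => x i.+1)) => // j; exact: x4 j.+1.
Qed.

(** The numbers [x_l]: the entry at [p] is chosen so that the [k] components of the constants
    cancel. *)
Definition cpart (p i : nat) : int :=
  if (i < p)%N then 5 ^+ i else - \sum_(j < p) 5 ^+ j.

Lemma sum_cpart_mul (p : nat) (d : nat -> int) :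
  \sum_(i < p.+1) d i * cpart p i = \sum_(i < p) (d i - d p) * 5 ^+ i.
Proof.
rewrite big_ord_recr /= {2}/cpart ltnn mulrN mulr_sumr -sumrB.
by apply: eq_bigr => i _; rewrite /cpart ltn_ord mulrBl.
Qed.

(** Eliminating the last entry leaves a base 5 relation with digits [d i - d p], of absolute value
    at most 4. *)
Lemma cpart_independent (p : nat) (d : nat -> int) :
  (forall i, (i <= p)%N -> `|d i| <= 2) ->
  \sum_(i < p.+1) d i * cpart p i = 0 -> forall i, (i <= p)%N -> d i = d p.
Proof.
move=> d2; rewrite sum_cpart_mul => S0 i; rewrite leq_eqVlt => /predU1P[->//|ip].
apply/eqP; rewrite -subr_eq0; apply/eqP; move: i ip.
apply: digits5_eq0 S0 => i ip.
by have := d2 i (ltnW ip); have := d2 p (leqnn p); lia.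
Qed.

(** The numbers [a_l]: the alternating signs add up to 0 or 1 by the parity of [p], and the last
    entry completes the total to 2. *)
Definition rpart (p i : nat) : int := if (i < p)%N then (-1) ^+ i else 2 - (odd p)%:Z.

Lemma sum_rpart (p : nat) : \sum_(i < p.+1) rpart p i = 2.
Proof.
rewrite big_ord_recr /= {2}/rpart ltnn.
rewrite (eq_bigr (fun i : 'I_p => (-1) ^+ i)); last by move=> i _; rewrite /rpart ltn_ord.
have -> : \sum_(i < p) (-1) ^+ i = (odd p)%:Z; last by lia.
elim: p => [|p IHp]; first by rewrite big_ord0.
rewrite big_ord_recr /= {}IHp -signr_odd; by case: (odd p).
Qed.

Lemma rpart_lt (p i : nat) : (i < p)%N -> rpart p i = 1 \/ rpart p i = -1.
Proof. by rewrite /rpart => ->; rewrite -signr_odd; case: odd; [right|left]. Qed.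

Lemma rpart_last (p : nat) : rpart p p = 1 \/ rpart p p = 2.
Proof. by rewrite /rpart ltnn; case: odd; [left|right]. Qed.

Lemma rpart_norm (p i : nat) : (i <= p)%N -> `|rpart p i| = 1 \/ `|rpart p i| = 2.
Proof.
rewrite leq_eqVlt => /predU1P[->|/rpart_lt]; last by case=> ->; left.
by case: (rpart_last p) => ->; [left|right].
Qed.

Definition pdet (p i j : nat) : int := rpart p j * cpart p i - rpart p i * cpart p j.

(** A zero determinant is a relation between [cpart p i] and [cpart p j] with coefficients
    [rpart p j] and [- rpart p i]. By [cpart_independent] the coefficient family, extended by zero,
    would be constant. *)
Lemma pdet_neq0 (p i j : nat) : (i < j)%N -> (j <= p)%N -> pdet p i j != 0.
Proof.
move=> ij jp; have ip := leq_trans ij jp; apply/eqP => det0.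
pose d k := if k == i then rpart p j else if k == j then - rpart p i else 0.
have dd k : (k <= p)%N -> d k = d p.
  apply: cpart_independent => {k}[k kp|].
    have := rpart_norm p i (ltnW ip); have := rpart_norm p j jp.
    by rewrite /d; case: eqP => _; [|case: eqP => _]; lia.
  have ip1 : (i < p.+1)%N by lia.
  have jp1 : (j < p.+1)%N by lia.
  rewrite (bigD1 (Ordinal ip1)) //= (bigD1 (Ordinal jp1)) /=; last first.
    by rewrite -val_eqE /=; lia.
  rewrite big1 => [|[k kp] /andP[]]; last first.
    by rewrite -!val_eqE /d /= => /negbTE-> /negbTE->; rewrite mul0r.
  by rewrite /d !eqxx gtn_eqF // addr0 mulNr.
have di : d i = rpart p j by rewrite /d eqxx.
have dj : d j = - rpart p i by rewrite /d eqxx gtn_eqF.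
have aij : rpart p j = - rpart p i by rewrite -di -dj !dd // ltnW.
have aj0 : rpart p j != 0 by have := rpart_norm p j jp; lia.
(* A zero coefficient contradicts constancy. If [j < p], it sits at [p]. If [j = p], it sits at 0,
   because [i = 0] would make [rpart p i] and [rpart p j] both positive. *)
have /predU1P[jE|jlt] : (j == p) || (j < p)%N by rewrite -leq_eqVlt.
  have i0 : i != 0%N.
    apply/eqP => i0; move: aij; rewrite i0 jE /rpart ltnn.
    by rewrite -[X in (X < p)%N]i0 ip; lia.
  have : d 0%N = rpart p j by rewrite (dd 0%N) // -(dd i) // ltnW.
  rewrite /d; case: eqP => [|_]; first by lia.
  by case: eqP => [|_]; lia.
have : d p = rpart p j by rewrite -(dd i) // ltnW.
by rewrite /d; do 2 (case: eqP => [|_]; first by lia); lia.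
Qed.

Definition scale (p : nat) : int :=
  3 * \prod_(i < p.+1) \prod_(j < p.+1 | (i < j)%N) pdet p i j.

Lemma scale_neq0 (p : nat) : scale p != 0.
Proof.
apply: mulf_neq0 => [//|]; apply/prodf_neq0 => i _; apply/prodf_neq0 => j ij.
by rewrite pdet_neq0 // -ltnS.
Qed.

Lemma pdet_dvd_scale (p i j : nat) : (i < j)%N -> (j <= p)%N ->
  exists q, scale p = pdet p i j * q.
Proof.
move=> ij; rewrite -ltnS => jp; have ip := ltn_trans ij jp.
rewrite /scale (bigD1 (Ordinal ip)) //= (bigD1 (Ordinal jp)) //=.
by rewrite -(mulrA (pdet p i j)) mulrCA; eexists.
Qed.

(** * Sums of two squares just below powers of 9 *)

Lemma sum_two_squares (t : nat) :
  exists r s : int, r ^+ 2 + s ^+ 2 + 1 = 9 ^+ (2 ^ t).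
Proof.
elim: t => [|t [r [s rs]]]; first by exists 2, 2.
pose q : int := 3 ^+ (2 ^ t).
(* These are the components of the Gaussian product [(r + s i) (q + i)], whose norm is
   [(q ^+ 2 - 1) * (q ^+ 2 + 1)]. *)
exists (r * q - s), (s * q + r).
have q2 : q ^+ 2 = r ^+ 2 + s ^+ 2 + 1 by rewrite rs -exprM mulnC exprM.
rewrite expnS mulnC exprM -rs; transitivity ((r ^+ 2 + s ^+ 2) * (q ^+ 2 + 1) + 1).
  by ring.
by rewrite q2; ring.
Qed.

(** * Quaternions with integer components and their norms *)

Fact lipschitz_subproof (a b c d : int) :
  Quat a%:~R b%:~R c%:~R d%:~R \in hurwitz.
Proof. by rewrite unfold_in /= !intr_int. Qed.

Definition lipschitz (a b c d : int) : hint := HInt (lipschitz_subproof a b c d).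

Lemma lipschitz_inj (a b c d a' b' c' d' : int) :
  lipschitz a b c d = lipschitz a' b' c' d' -> [/\ a = a', b = b', c = c' & d = d'].
Proof.
move=> /(congr1 hint_val)/= [].
by move=> /intr_inj-> /intr_inj-> /intr_inj-> /intr_inj->.
Qed.

Lemma lipschitzD (a b c d a' b' c' d' : int) :
  lipschitz a b c d + lipschitz a' b' c' d' =
  lipschitz (a + a') (b + b') (c + c') (d + d').
Proof. by apply: val_inj; rewrite [LHS]addqE /addq /= !intrD. Qed.

Lemma lipschitzM (a b c d a' b' c' d' : int) :
  lipschitz a b c d * lipschitz a' b' c' d' =
  lipschitz (a * a' - b * b' - c * c' - d * d') (a * b' + b * a' + c * d' - d * c')
            (a * c' - b * d' + c * a' + d * b') (a * d' + b * c' - c * b' + d * a').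
Proof. by apply: val_inj; rewrite [LHS]mulqE /Defs.mulq /= !(intrD, intrN, intrM). Qed.

Lemma lipschitz0 : lipschitz 0 0 0 0 = 0.
Proof. exact: val_inj. Qed.

Lemma lipschitz_int (z : int) : lipschitz z 0 0 0 = z%:~R.
Proof.
have L1 : lipschitz 1 0 0 0 = 1 by apply: val_inj.
have LN n : lipschitz (- n) 0 0 0 = - lipschitz n 0 0 0.
  by apply/eqP; rewrite -addr_eq0 lipschitzD addNr addr0 lipschitz0.
have Ln (n : nat) : lipschitz n 0 0 0 = n%:R.
  by elim: n => [|n IHn]; [exact: lipschitz0 | rewrite -addn1 natrD -IHn -L1 lipschitzD].
case: z => n; first exact: Ln.
by rewrite NegzE LN Ln mulrNz.
Qed.

Lemma lipschitzMz (a b c d z : int) :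
  lipschitz a b c d *~ z = lipschitz (a * z) (b * z) (c * z) (d * z).
Proof. by rewrite -mulrzr -lipschitz_int lipschitzM; congr lipschitz; ring. Qed.

Lemma sum_lipschitz (n : nat) (a b c d : nat -> int) :
  \sum_(i < n) lipschitz (a i) (b i) (c i) (d i) =
  lipschitz (\sum_(i < n) a i) (\sum_(i < n) b i) (\sum_(i < n) c i) (\sum_(i < n) d i).
Proof.
elim: n => [|n IHn]; first by rewrite !big_ord0 lipschitz0.
by rewrite !big_ord_recr /= IHn lipschitzD.
Qed.

Lemma hnorm_lipschitz (a b c d : int) :
  hnorm (lipschitz a b c d) = `|(a ^+ 2 + b ^+ 2 + c ^+ 2 + d ^+ 2)%R|%N.
Proof.
rewrite /hnorm /Defs.normq /= -(numq_int (a ^+ 2 + b ^+ 2 + c ^+ 2 + d ^+ 2)).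
by rewrite !(intrD, intrM, expr2).
Qed.

Lemma normqM (z w : quat) : Defs.normq (z * w) = Defs.normq z * Defs.normq w.
Proof. by case: z w => [? ? ? ?] [? ? ? ?]; rewrite mulqE /Defs.normq /Defs.mulq /=; ring. Qed.

Lemma hnormM (z w : hint) : hnorm (z * w) = (hnorm z * hnorm w)%N.
Proof. by apply/eqP; rewrite -(eqr_nat rat) natrM !hnormE normqM. Qed.

Lemma hnorm1 : hnorm 1 = 1%N.
Proof. by []. Qed.

Lemma hnorm_prod (n : nat) (a : 'I_n -> hint) :
  hnorm (\prod_(i < n) a i) = (\prod_(i < n) hnorm (a i))%N.
Proof.
elim: n a => [|n IHn] a; first by rewrite !big_ord0.
by rewrite !big_ord_recr /= hnormM IHn.
Qed.

Lemma hnorm_unit (u : hint) : is_unit u -> hnorm u = 1%N.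
Proof.
by case=> v [uv _]; apply/eqP; rewrite -dvdn1 -hnorm1 -uv hnormM dvdn_mulr.
Qed.

(** * Coprimality and divisibility criteria *)

(** The same coefficients serve on both sides, so that one witness treats left and right divisors
    together. *)
Definition two_sided_combination (x y r : hint) :=
  exists a b, x * a + y * b = r /\ a * x + b * y = r.

Definition left_right_coprime (x y : hint) :=
  is_left_gcd 1 [set x; y] /\ is_right_gcd 1 [set x; y].

(** A common left or right divisor of [x] and [y] divides both integers [m] and [n], hence 1 by
    their Bezout relation. *)
Lemma coprime_combinations (x y : hint) (m n : int) : coprimez m n ->
  two_sided_combination x y m%:~R -> two_sided_combination x y n%:~R ->
  left_right_coprime x y.
Proof.
move=> /coprimezP[[u v] /= uv1] [a [b [mE mE']]] [c [d [nE nE']]].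
have E1 : m%:~R * u%:~R + n%:~R * v%:~R = 1 :> hint.
  by rewrite -!intrM -intrD mulrC (mulrC n) uv1.
have E1' : u%:~R * m%:~R + v%:~R * n%:~R = 1 :> hint.
  by rewrite -!intrM -intrD uv1.
split; split=> [z _|e exy].
- by exists z; rewrite mul1r.
- have [[x' xE] [y' yE]] : left_divides e x /\ left_divides e y.
    by split; apply: exy; [left|right].
  exists ((x' * a + y' * b) * u%:~R + (x' * c + y' * d) * v%:~R).
  by rewrite mulrDr !mulrA !mulrDr !mulrA -xE -yE mE nE E1.
- by exists z; rewrite mulr1.
- have [[x' xE] [y' yE]] : right_divides e x /\ right_divides e y.
    by split; apply: exy; [left|right].
  exists (u%:~R * (a * x' + b * y') + v%:~R * (c * x' + d * y')).
  by rewrite mulrDl -!mulrA !mulrDl -!mulrA -xE -yE mE' nE' E1'.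
Qed.

(** A quaternion times its conjugate, in either order, is its norm. *)
Lemma norm_combinationl (a b c d : int) (y : hint) :
  two_sided_combination (lipschitz a b c d) y (a ^+ 2 + b ^+ 2 + c ^+ 2 + d ^+ 2)%:~R.
Proof.
exists (lipschitz a (- b) (- c) (- d)), 0; rewrite mul0r mulr0 !addr0 -lipschitz_int !lipschitzM.
by split; congr lipschitz; ring.
Qed.

Lemma two_sided_combinationC (x y r : hint) :
  two_sided_combination x y r -> two_sided_combination y x r.
Proof. by move=> [a [b [E E']]]; exists b, a; rewrite addrC E addrC. Qed.

(* A Hurwitz integer with a zero component has integer components. *)
Lemma natr_divides_lipschitz (f : nat) (a b c d : int) :
  b = 0 \/ d = 0 -> left_divides f%:R (lipschitz a b c d) -> (f %| `|a|)%N.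
Proof.
have [->|f0] := eqVneq f 0%N.
  move=> _ [z]; rewrite mul0r -lipschitz0 => /lipschitz_inj[-> _ _ _].
  by rewrite dvdn0.
have half_nint : (0 : rat) - 2^-1 \isn't a Num.int by [].
have fQ0 : (f : int)%:~R != 0 :> rat by rewrite intr_eq0.
have -> : f%:R = lipschitz f 0 0 0 by rewrite lipschitz_int.
move=> bd0 [[[q r s t] zH]] /(congr1 hint_val)/=.
rewrite mulqE /Defs.mulq /= mulr0z !mul0r ?subr0 ?addr0 => -[aE bE cE dE].
move: zH; rewrite unfold_in /= => /orP[/and4P[/intrP[m qE] _ _ _]|/and4P[_ rH _ tH]].
  move: aE; rewrite qE -intrM => /intr_inj ->.
  by rewrite abszM dvdn_mulr.
(* With half-integral components neither [r] nor [t] vanishes, whereas [b = f * r] and [d = f * t]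
   are not both nonzero. *)
have r0 : r != 0 by apply: contraNneq half_nint => <-.
have t0 : t != 0 by apply: contraNneq half_nint => <-.
case: bd0 => x0; [move: bE|move: dE]; rewrite x0 => /esym/eqP;
  by rewrite mulf_eq0 (negbTE fQ0) /= ?(negbTE r0) ?(negbTE t0).
Qed.

(** * The solution tuple and its membership in [U] *)

Definition constant_term (p i : nat) : hint :=
  lipschitz (rpart p i) 0 0 (scale p * cpart p i).

(** Here [n = p + 3]: the [n - 2] constants come first, followed by [u - 1] and [-u - 1]. *)
Definition solution_term (p : nat) (r s : int) (i : nat) : hint :=
  if (i < p.+1)%N then constant_term p i
  else if (i == p.+1)%N then lipschitz (-1) r s 0 else lipschitz (-1) (- r) (- s) 0.

Definition solution (p : nat) (r s : int) : {ffun 'I_p.+3 -> hint} :=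
  [ffun i : 'I_p.+3 => solution_term p r s i].

Variant solution_term_spec (p : nat) (r s : int) (i : nat) : hint -> Prop :=
| SolutionConstant of (i <= p)%N :
    solution_term_spec p r s i (constant_term p i)
| SolutionU of i = p.+1 :
    solution_term_spec p r s i (lipschitz (-1) r s 0)
| SolutionV of i = p.+2 :
    solution_term_spec p r s i (lipschitz (-1) (- r) (- s) 0).

Lemma solutionP (p : nat) (r s : int) (i : 'I_p.+3) :
  solution_term_spec p r s i (solution p r s i).
Proof.
rewrite ffunE /solution_term ltnS; case: leqP => [|pi]; first exact: SolutionConstant.
have := ltn_ord i; case: eqP => [ip _|ip ip3]; first exact: SolutionU.
by apply: SolutionV; lia.
Qed.

(** Componentwise form of a weighted sum, used both for the zero sum and for excluding vanishing
    subsums. *)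
Lemma sum_solution_term (p : nat) (r s : int) (b : nat -> int) :
  \sum_(i < p.+3) solution_term p r s i *~ b i =
  lipschitz (\sum_(i < p.+1) rpart p i * b i - b p.+1 - b p.+2)
            (r * (b p.+1 - b p.+2)) (s * (b p.+1 - b p.+2))
            (scale p * \sum_(i < p.+1) b i * cpart p i).
Proof.
rewrite 2!big_ord_recr /= {2 3}/solution_term ltnn eqxx ltnNge leqnSn /= gtn_eqF //.
rewrite (eq_bigr (fun i : 'I_p.+1 => lipschitz (rpart p i * b i) (0 * b i) (0 * b i)
    (scale p * cpart p i * b i))); last first.
  by move=> i _; rewrite /solution_term ltn_ord lipschitzMz.
rewrite (sum_lipschitz _ (fun i => rpart p i * b i) (fun i => 0 * b i)
  (fun i => 0 * b i) (fun i => scale p * cpart p i * b i)).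
have sum0 : \sum_(i < p.+1) 0 * b i = 0 by apply: big1 => i _; rewrite mul0r.
rewrite !lipschitzMz !lipschitzD sum0 mulr_sumr.
congr lipschitz; [ring | ring | ring |].
by rewrite !mul0r !addr0; apply: eq_bigr => i _; ring.
Qed.

Lemma solution_sum0 (p : nat) (r s : int) : \sum_i solution p r s i = 0.
Proof.
rewrite (eq_bigr (fun i : 'I_p.+3 => solution_term p r s i *~ 1)) => [|i _]; last first.
  by rewrite ffunE mulr1z.
rewrite (sum_solution_term _ _ _ (fun=> 1)) subrr !mulr0.
rewrite (eq_bigr (fun i : 'I_p.+1 => rpart p i)) => [|i _]; last by rewrite mulr1.
rewrite sum_rpart (sum_cpart_mul p (fun=> 1)) big1 => [|i _]; last by rewrite subrr mul0r.
by rewrite mulr0 lipschitz0.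
Qed.

(** The [i] and [j] components force equal coefficients on the last two terms, the [k] component
    equal coefficients on the constants, and the real component equates the two values. So 0 and 1
    cannot both occur. *)
Lemma solution_no_vanishing_subsum (p : nat) (r s : int) : r ^+ 2 + s ^+ 2 != 0 ->
  no_vanishing_subsum [:: -1; 0; 1] (solution p r s).
Proof.
move=> rs0 [b [i [j [b01 bi0 bj1 sum0]]]].
(* Extending [b] to all naturals through [inord] keeps its values in the allowed set. *)
pose b' k := b (inord k).
have b'E k : b k = b' k by rewrite /b' inord_val.
have b'1 k : `|b' k| <= 1.
  by have := b01 (inord k); rewrite /b' !inE => /or3P[] /eqP->.
move: sum0; rewrite (eq_bigr (fun i : 'I_p.+3 => solution_term p r s i *~ b' i)); last first.
  by move=> k _; rewrite ffunE b'E.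
rewrite sum_solution_term -lipschitz0 => /lipschitz_inj[re0 i0 j0 k0].
have b_uv : b' p.+1 = b' p.+2.
  apply/eqP; rewrite -subr_eq0; apply: contraNT rs0 => b0.
  by move/eqP: i0; move/eqP: j0; rewrite !mulf_eq0 (negbTE b0) !orbF => /eqP-> /eqP->.
have b_c : forall i, (i <= p)%N -> b' i = b' p.
  apply: cpart_independent => [k _|]; first by have := b'1 k; lia.
  by move/eqP: k0; rewrite mulf_eq0 (negbTE (scale_neq0 p)) => /eqP.
have b_pu : b' p = b' p.+2.
  move: re0; rewrite (eq_bigr (fun i : 'I_p.+1 => rpart p i * b' p)) => [|k _]; last first.
    by rewrite b_c // -ltnS.
  by rewrite -mulr_suml sum_rpart b_uv; lia.
have b_const k : (k < p.+3)%N -> b' k = b' p.+2.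
  rewrite ltnS leq_eqVlt => /predU1P[->//|]; rewrite ltnS leq_eqVlt => /predU1P[->//|].
  by move/b_c ->.
move: bi0 bj1; rewrite !b'E (b_const i) // (b_const j) // => ->.
by [].
Qed.

Lemma coprimez_succ_mul (x y : int) : coprimez (1 + x * y) x.
Proof. by apply/coprimezP; exists (1, - y) => /=; ring. Qed.

(** As [i] is not the last index, its real part is a sign, so its norm is 1 modulo [scale p]. It is
    therefore coprime to [scale p] and to its divisor [pdet p i j]. *)
Lemma constant_terms_coprime (p i j : nat) : (i < j)%N -> (j <= p)%N ->
  left_right_coprime (constant_term p i) (constant_term p j).
Proof.
move=> ij jp; have ip := leq_trans ij jp.
have [q Kq] := pdet_dvd_scale p i j ij jp.
apply: (@coprime_combinations _ _ (1 + scale p * (scale p * cpart p i ^+ 2))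
          (scale p * pdet p i j)).
- rewrite coprimezMr coprimez_succ_mul {1}Kq -mulrA.
  exact: coprimez_succ_mul.
- have -> : 1 + scale p * (scale p * cpart p i ^+ 2) =
    rpart p i ^+ 2 + 0 ^+ 2 + 0 ^+ 2 + (scale p * cpart p i) ^+ 2.
    by case: (rpart_lt p i ip) => ->; ring.
  exact: norm_combinationl.
(* These multiples of [k] commute with the constants; the real parts contribute cancelling multiples
   of [k], and the [k] parts become an integer. *)
- exists (lipschitz 0 0 0 (- rpart p j)), (lipschitz 0 0 0 (rpart p i)).
  rewrite /constant_term -lipschitz_int !lipschitzM !lipschitzD /pdet.
  by split; congr lipschitz; ring.
Qed.

(** The real part squares to 1 or 4, both 1 modulo 3, and 3 divides [scale p]. *)
Lemma coprimez3_constant_norm (p i : nat) : (i <= p)%N ->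
  coprimez 3 (rpart p i ^+ 2 + 0 ^+ 2 + 0 ^+ 2 + (scale p * cpart p i) ^+ 2).
Proof.
move=> ip; have [k aE] : exists k, rpart p i ^+ 2 = 1 + 3 * k.
  by have [|] := rpart_norm p i ip; rewrite -real_normK ?num_real // => ->; [exists 0|exists 1].
rewrite coprimez_sym {}aE /scale; set P := \prod_(_ < _) _.
have -> : 1 + 3 * k + 0 ^+ 2 + 0 ^+ 2 + (3 * P * cpart p i) ^+ 2 =
  1 + 3 * (k + 3 * (P * cpart p i) ^+ 2) by ring.
exact: coprimez_succ_mul.
Qed.

Section Solution.
Variables (p t : nat) (r s : int).
Hypothesis rsE : r ^+ 2 + s ^+ 2 + 1 = 9 ^+ (2 ^ t).

Let norm_uE : 9 ^+ (2 ^ t) = (-1) ^+ 2 + r ^+ 2 + s ^+ 2 + 0 ^+ 2.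
Proof. by rewrite -rsE; ring. Qed.

Let norm_vE : 9 ^+ (2 ^ t) = (-1) ^+ 2 + (- r) ^+ 2 + (- s) ^+ 2 + 0 ^+ 2.
Proof. by rewrite -rsE; ring. Qed.

Lemma constant_variable_coprime (i : nat) (x : hint) : (i <= p)%N ->
  two_sided_combination x (constant_term p i) (9 ^+ (2 ^ t))%:~R ->
  left_right_coprime (constant_term p i) x.
Proof.
move=> ip xN; apply: coprime_combinations (two_sided_combinationC _ _ _ xN).
  have := coprimez3_constant_norm p i ip; rewrite coprimez_sym => c3.
  apply: coprimezXr; exact: (coprimezXr 2 c3).
exact: norm_combinationl.
Qed.

Lemma solution_coprime (i j : 'I_p.+3) : (i < j)%N ->
  left_right_coprime (solution p r s i) (solution p r s j).
Proof.
have cu k : (k <= p)%N -> left_right_coprime (constant_term p k) (lipschitz (-1) r s 0).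
  by move=> kp; apply: constant_variable_coprime => //; rewrite norm_uE; apply: norm_combinationl.
have cv k : (k <= p)%N -> left_right_coprime (constant_term p k) (lipschitz (-1) (- r) (- s) 0).
  by move=> kp; apply: constant_variable_coprime => //; rewrite norm_vE; apply: norm_combinationl.
(* The norm is odd and the sum of the two terms is -2. *)
have uv : left_right_coprime (lipschitz (-1) r s 0) (lipschitz (-1) (- r) (- s) 0).
  apply: (@coprime_combinations _ _ (9 ^+ (2 ^ t)) (-2)); first exact: coprimezXl.
    by rewrite norm_uE; apply: norm_combinationl.
  by exists 1, 1; rewrite !mulr1 !mul1r -lipschitz_int lipschitzD; split; congr lipschitz; ring.
case: (solutionP p r s i) => [ip|ip|ip]; case: (solutionP p r s j) => [jp|jp|jp] ij //;
  try lia.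
- exact: constant_terms_coprime.
- exact: cu.
- exact: cv.
Qed.

(** Each term has a zero [i] or [k] component, so [f] would divide its real part, which is 1 or 2 in
    absolute value. *)
Lemma solution_not_dvd (i : 'I_p.+3) (f : nat) : (3 <= f)%N ->
  ~ left_divides f%:R (solution p r s i).
Proof.
move=> f3; have f_ndvd (a : int) : `|a| = 1 \/ `|a| = 2 -> ~ (f %| `|a|)%N.
  by move=> a12 /dvdn_leq; lia.
case: (solutionP p r s i) => [ip|_|_] /natr_divides_lipschitz.
- by move=> H; apply: f_ndvd (H (or_introl erefl)); apply: rpart_norm.
- by move=> H; apply: f_ndvd (H (or_intror erefl)); left.
- by move=> H; apply: f_ndvd (H (or_intror erefl)); left.
Qed.

Lemma solution_nonzero : nonzero_tuple (solution p r s).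
Proof.
move=> i; apply/eqP => i0; apply: (solution_not_dvd i 3 isT).
by exists 0; rewrite mulr0.
Qed.

Lemma solution_U (F : {fset nat}) : (forall f, f \in F -> (3 <= f)%N) ->
  U p.+3 F (solution p r s).
Proof.
move=> F3; split.
- exact: solution_nonzero.
- exact: solution_sum0.
- apply: solution_no_vanishing_subsum.
  have : 9 <= 9 ^+ (2 ^ t) :> int by rewrite -[leLHS]expr1 ler_eXn2l // expn_gt0.
  by rewrite -rsE; lia.
- by move=> i j ij; apply: solution_coprime.
- by move=> j f fF; apply: solution_not_dvd; apply: F3.
Qed.

(** * Norms and quality of the solution *)

Definition constant_norm : nat := (\prod_(i < p.+1) hnorm (constant_term p i))%N.

Lemma hnorm_u : hnorm (lipschitz (-1) r s 0) = (9 ^ (2 ^ t))%N.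
Proof. by rewrite hnorm_lipschitz -norm_uE abszX. Qed.

Lemma hnorm_v : hnorm (lipschitz (-1) (- r) (- s) 0) = (9 ^ (2 ^ t))%N.
Proof. by rewrite hnorm_lipschitz -norm_vE abszX. Qed.

Lemma hnorm_prod_solution :
  hnorm (\prod_i solution p r s i) = (3 ^ (4 * 2 ^ t) * constant_norm)%N.
Proof.
rewrite hnorm_prod (eq_bigr (fun i : 'I_p.+3 => hnorm (solution_term p r s i))); last first.
  by move=> i _; rewrite ffunE.
rewrite 2!big_ord_recr /= {2 3}/solution_term ltnn eqxx ltnNge leqnSn /= gtn_eqF //.
rewrite hnorm_u hnorm_v (eq_bigr (fun i : 'I_p.+1 => hnorm (constant_term p i))); last first.
  by move=> i _; rewrite /solution_term ltn_ord.
rewrite -/constant_norm -mulnA -expnD mulnC; congr (_ * _)%N.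
by rewrite -[9%N]/(3 ^ 2)%N -expnM; congr (_ ^ _)%N; lia.
Qed.

Lemma constant_norm_gt0 : (0 < constant_norm)%N.
Proof.
rewrite prodn_gt0 // => i; rewrite hnorm_lipschitz absz_gt0.
have := coprimez3_constant_norm p i (ltn_ord i).
by apply: contraTneq => ->.
Qed.

Lemma solution_not_unit : ~ unit_tuple (solution p r s).
Proof.
move=> /(_ (inord p.+1))/hnorm_unit; rewrite ffunE inordK // /solution_term ltnn eqxx hnorm_u.
by move/eqP; rewrite -[X in _ == X](expn0 9) eqn_exp2l // expn_eq0.
Qed.

(** The term [u - 1] alone gives the numerator; the denominator does not depend on [t], because the
    powers of 3 contribute at most one factor 3 to the radical. *)
Lemma solution_quality (R : realType) :
  ln 9 * (2 ^ t)%:R / ln (3 * constant_norm)%:R <= quality R (solution p r s).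
Proof.
rewrite /quality hnorm_prod_solution; set m := (3 ^ _ * _)%N.
(* A radical above 1 has a positive logarithm, as needed to compare the inverses. *)
have rad3 : (3 <= Defs.rad m)%N.
  apply: leq_rad => //; first by rewrite muln_gt0 expn_gt0 constant_norm_gt0.
  by rewrite /m dvdn_mulr // dvdn_exp // muln_gt0 expn_gt0.
have radL : (Defs.rad m <= 3 * constant_norm)%N.
  by apply: rad_leq => //; exact: constant_norm_gt0.
have ln_rad : 0 < ln (Defs.rad m)%:R :> R by rewrite ln_gt0 // ltr1n; lia.
apply: ler_pM; first by rewrite mulr_ge0 // ln_ge0 // ler1n.
- by rewrite invr_ge0 ln_ge0 // ler1n; lia.
- have -> : ln 9 * (2 ^ t)%:R = ln (9 ^ (2 ^ t))%:R :> R.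
    by rewrite [in RHS]natrX lnXn ?ltr0n // mulr_natr.
  have max_ge : (9 ^ (2 ^ t) <= \max_(i < p.+3) hnorm (solution p r s i))%N.
    rewrite -hnorm_u.
    have -> : lipschitz (-1) r s 0 = solution p r s (inord p.+1).
      by rewrite ffunE inordK // /solution_term ltnn eqxx.
    exact: leq_bigmax.
  have n0 : (0 < 9 ^ (2 ^ t))%N by rewrite expn_gt0.
  by rewrite ler_ln ?posrE ?ltr0n ?ler_nat // (leq_trans n0).
- rewrite lef_pV2 ?posrE //; last by rewrite ln_gt0 // ltr1n; lia.
  by rewrite ler_ln ?posrE ?ltr0n ?ler_nat //; lia.
Qed.

End Solution.

(** * Unboundedness on [U] and [A], and the three bounds *)

Lemma U_unbounded (R : realType) (n : nat) (F : {fset nat}) (M : R) :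
  (3 <= n)%N -> (forall f, f \in F -> (3 <= f)%N) ->
  exists a, [/\ U n F a, ~ unit_tuple a & M < quality R a].
Proof.
case: n => [|[|[|p]]] // _ F3.
pose c : R := ln 9 / ln (3 * constant_norm p)%:R.
have c0 : 0 < c.
  have := constant_norm_gt0 p => L0.
  by rewrite divr_gt0 // ln_gt0 // ltr1n //; lia.
(* The quality is at least [c * 2 ^ t], and [2 ^ t] exceeds [t], which exceeds [M / c]. *)
pose t := Num.bound `|M / c|; have [r [s rsE]] := sum_two_squares t.
exists (solution p r s); split.
- exact: solution_U rsE _ F3.
- exact: solution_not_unit rsE.
apply: lt_le_trans (solution_quality _ _ _ _ rsE R).
rewrite mulrAC -/c -ltr_pdivrMl // mulrC.
apply: le_lt_trans (ler_norm _) _; apply: lt_trans (archi_boundP (normr_ge0 _)) _.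
by rewrite ltr_nat ltn_expl.
Qed.

(** A common divisor of all entries divides the first two, which are coprime; coefficients 0 and 1
    are among those excluded in [U]. *)
Lemma U_fset0_sub_A (n : nat) : (3 <= n)%N -> U n fset0 `<=` A n.
Proof.
move=> n3 a [a0 asum nosub acop _].
have n0 : (0 < n)%N by lia.
have n1 : (1 < n)%N by lia.
have [[_ lgcd] [_ rgcd]] := acop (Ordinal n0) (Ordinal n1) isT.
split=> //; first by move=> [b [i [j [b01 bi bj bsum]]]]; apply: nosub; exists b, i, j;
  split=> // k; move: (b01 k); rewrite !inE => ->; rewrite orbT.
split; split=> [x _|e ediv].
- by exists x; rewrite mul1r.
- by apply: lgcd => x [] ->; apply: ediv; eexists.
- by exists x; rewrite mulr1.
- by apply: rgcd => x [] ->; apply: ediv; eexists.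
Qed.

Theorem theorem4p8 (R : realType) :
  [/\ forall (n : nat) (F : {fset nat}),
        odd n -> (5 <= n)%N ->
        (forall f, f \in F -> (3 <= f)%N) ->
        (forall f, f \in F ->
           [/\ ~~ (f %| 2)%N, ~~ (f %| 5)%N & ~~ (f %| 10)%N]) ->
        infinite_set (U n F) /\ ((10 / 3)%:E <= Q R (U n F))%E,
      forall (n : nat) (F : {fset nat}),
        (6 <= n)%N ->
        (forall f, f \in F -> (3 <= f)%N) ->
        infinite_set (U n F) /\ ((5 / 2)%:E <= Q R (U n F))%E &
      forall n : nat,
        (3 <= n)%N ->
        infinite_set (A n) /\ ((4 * n%:R - 10)%:E <= Q R (A n))%E].
Proof.
split=> [n F _ n5 F3 _|n F n6 F3|n n3].
- have unb M := U_unbounded R n F M (leq_trans (isT : 3 <= 5)%N n5) F3.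
  by split; [exact: infinite_quality_unbounded unb | rewrite Q_quality_unbounded ?leey].
- have unb M := U_unbounded R n F M (leq_trans (isT : 3 <= 6)%N n6) F3.
  by split; [exact: infinite_quality_unbounded unb | rewrite Q_quality_unbounded ?leey].
have unb (M : R) : exists a, [/\ A n a, ~ unit_tuple a & M < quality R a].
  have [//|a [Ua nu Ma]] := U_unbounded R n fset0 M n3.
  by exists a; split=> //; apply: U_fset0_sub_A.
by split; [exact: infinite_quality_unbounded unb | rewrite Q_quality_unbounded ?leey].
Qed.
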